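(* Let $j,k,\ell\ge 0$ be integers and let $G=P(j,k,\ell)$. Then $s^+(G)\ge j+k+\ell+3=n$, where $n$ is the order of $G$.
   Context: All graphs are finite and simple. For a graph $G$ with adjacency eigenvalues $\lambda_i(G)$, $s^+(G)=\sum_{\lambda_i(G)>0}\lambda_i(G)^2$. For integers $j,k,\ell\ge 0$, $P(j,k,\ell)$ is the graph obtained from a triangle by attaching, at its three distinct vertices, pendant paths with $j$, $k$ and $\ell$ new vertices respectively (the first new vertex of each path adjacent to its triangle vertex); thus $|V(P(j,k,\ell))|=3+j+k+\ell$. *)

(* Defs.v *)
From HB Require Import structures.
From mathcomp Require Import all_boot all_order all_algebra.
From mathcomp Require Import polyrcf complex spectral.
From mathcomp Require Import reals.

Set Implicit Arguments.
Unset Strict Implicit.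
Unset Printing Implicit Defensive.

Import Order.TTheory GRing.Theory Num.Theory.

Local Open Scope ring_scope.

Record sgraph := SGraph {
  vertex :> finType;
  edge : rel vertex;
  edge_sym : symmetric edge;
  edge_irrefl : irreflexive edge }.

Definition adjacency (R : realType) (G : sgraph) : 'M[R]_#|G| :=
  \matrix_(i, j) (edge (enum_val i) (enum_val j))%:R.

(* Real eigenvalues in increasing order, each repeated according to its
   multiplicity as a root of the characteristic polynomial; by
   [prod_eigenvalues] below this is the full spectrum of a real symmetric
   matrix. *)
Definition eigenvalues (R : realType) (n : nat) (A : 'M[R]_n) : seq R :=
  flatten [seq nseq (mup x (char_poly A)) x | x <- rootsR (char_poly A)].

Lemma char_poly_split (R : realType) n (A : 'M[R]_n) : A^T = A ->
  exists s : seq R, char_poly A = \prod_(x <- s) ('X - x%:P).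
Proof.
move=> symA; pose Ac := map_mx (real_complex R) A.
have Aherm : Ac \is hermsymmx.
  apply/is_hermitianmxP; rewrite expr0 scale1r.
  apply/matrixP=> i j; rewrite !mxE -[in LHS]symA !mxE.
  by rewrite conj_Creal //; apply/complex_realP; exists (A j i).
have /orthomx_spectralP eqA := hermitian_normalmx Aherm.
have /mxOverP dreal := hermitian_spectral_diag_real Aherm.
set d := spectral_diag Ac in eqA dreal.
have Pu : spectralmx Ac \in unitmx by exact: spectral_unit.
exists [seq complex.Re (d 0 i) | i <- enum 'I_n].
apply: (map_poly_inj (real_complex R)).
rewrite map_char_poly -/Ac [in LHS]eqA.
have -> : char_poly (invmx (spectralmx Ac) *m diag_mx d *m spectralmx Ac)
        = char_poly (diag_mx d).
  rewrite /char_poly /char_poly_mx; set P := spectralmx Ac in Pu *.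
  have Pu' : map_mx polyC P \in unitmx by rewrite map_unitmx.
  have -> : 'X%:M - map_mx polyC (invmx P *m diag_mx d *m P) =
     invmx (map_mx polyC P) *m ('X%:M - map_mx polyC (diag_mx d)) *m map_mx polyC P.
    rewrite mulmxBr mulmxBl !map_mxM map_invmx.
    by rewrite scalar_mxC -['X%:M *m _ *m _]mulmxA mulVmx // mulmx1.
  rewrite !det_mulmx mulrAC -det_mulmx mulVmx // det1 mul1r //.
rewrite char_poly_trig ?diag_mx_is_trig // rmorph_prod big_map big_enum.
apply: eq_bigr => i _; rewrite !mxE eqxx mulr1n rmorphB /= map_polyX map_polyC /=.
by rewrite RRe_real.
Qed.

Lemma prod_eigenvalues (R : realType) n (A : 'M[R]_n) : A^T = A ->
  char_poly A = \prod_(x <- eigenvalues A) ('X - x%:P).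
Proof.
move=> /char_poly_split[s eqs].
have p0 : char_poly A != 0 by rewrite monic_neq0 ?char_poly_monic.
rewrite {1}eqs; apply: perm_big; apply/allP => x _ /=; apply/eqP.
rewrite -mu_prod_XsubC -eqs /eigenvalues count_flatten -map_comp.
rewrite sumnE big_map (eq_bigr (fun y => (if y == x then 1 else 0) * mup x (char_poly A)))%N; last first.
  by move=> y _ /=; rewrite count_nseq /=; case: eqP => [->|].
rewrite -big_distrl -big_mkcond sum1_count /=.
rewrite count_uniq_mem ?(lt_sorted_uniq (sorted_roots _ _ _)) //.
rewrite -(roots_on_rootsR p0) /=.
by case: (boolP (root _ x)) => [_|/mupNroot->]; rewrite ?mul1n.
Qed.

Definition s_plus (R : realType) (G : sgraph) : R :=
  \sum_(x <- eigenvalues (adjacency R G) | 0 < x) x ^+ 2.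

Lemma adjacency_sym (R : realType) (G : sgraph) :
  (adjacency R G)^T = adjacency R G.
Proof. by apply/matrixP=> a b; rewrite !mxE edge_sym. Qed.

Section TrianglePaths.

Variables j k l : nat.

Definition leg (i : 'I_3) : nat := nth 0%N [:: j; k; l] i.

(* [inl i] is the triangle vertex i; [inr (Tagged _ a)], with a : 'I_(leg i),
   is the a-th new vertex (counted from 0, starting next to the triangle) of
   the path attached at i. *)
Definition Pvertex : finType := ('I_3 + {i : 'I_3 & 'I_(leg i)})%type.

Definition Pedge (u v : Pvertex) : bool :=
  match u, v with
  | inl a, inl b => a != b
  | inl a, inr y => (a == tag y) && (tagged y == 0 :> nat)%N
  | inr x, inl b => (b == tag x) && (tagged x == 0 :> nat)%N
  | inr x, inr y => (tag x == tag y) &&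
      (((tagged x).+1 == tagged y :> nat) ||
       ((tagged y).+1 == tagged x :> nat))%N
  end.

Lemma Pedge_sym : symmetric Pedge.
Proof. by move=> [a|x] [b|y] //=; rewrite eq_sym // orbC. Qed.

Lemma Pedge_irrefl : irreflexive Pedge.
Proof. by move=> [a|x] /=; rewrite eqxx //= gtn_eqF. Qed.

Definition P : sgraph := SGraph Pedge_sym Pedge_irrefl.

End TrianglePaths.

(* Main.v *)
Require Import Defs.
From mathcomp Require Import all_boot all_order all_algebra.
From mathcomp Require Import fingroup perm complex.
From mathcomp Require Import boolp classical_sets functions reals topology.
From mathcomp Require Import normedtype derive realfun trigo.
From mathcomp Require Import ring lra zify.

Set Implicit Arguments.
Unset Strict Implicit.
Unset Printing Implicit Defensive.

Import Order.TTheory GRing.Theory Num.Theory numFieldNormedType.Exports.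

Local Open Scope classical_set_scope.
Local Open Scope ring_scope.

(* Let [A] be the adjacency matrix, with eigenvalues [c].  Eliminating the
   vertices of the pendant paths from the leaves inwards turns [det (x + iA)],
   [x > 0], into a positive number times
     [det [[p, i, i], [i, q, i], [i, i, r]] = pqr + p + q + r - 2i]
   with [p, q, r > 0].  So [\prod_c (x + ic)] always has positive real part and
   negative imaginary part; by continuity of its argument,
   [Theta y = \sum_c atan (c y) <= 0] for all [y > 0].  As [\sum_c c = 0], the
   function [y |-> \sum_c (y^-2 + c^2) atan (c y)] has derivative
   [- 2 Theta y / y^3 >= 0]; it increases from [0] at [0+] to
   [pi / 2 * \sum_c c|c|] at infinity.  Thus [\sum_c c|c| >= 0], that is,
   [s^+ >= s^-], while [s^+ + s^- = tr A^2 = 2n]. *)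

(** * From the argument of [\prod_c (1 + icy)] to [\sum_c c|c|] *)

Lemma is_derive_atanZ (R : realType) (c x : R) :
  is_derive x 1 (fun y => atan (c * y)) (c / (1 + (c * x) ^+ 2)).
Proof.
have dc : is_derive x 1 (fun y : R => c * y) c.
  have := is_deriveZ c (is_derive_id x (1 : R)).
  by rewrite /GRing.scale /= mulr1.
have := @is_derive1_comp _ atan (fun y => c * y) x _ _ (is_derive1_atan (c * x)) dc.
by rewrite mulrC.
Qed.

Lemma is_derive_sum_seq (R : realType) (I : Type) (s : seq I) (f : I -> R -> R)
    (df : I -> R) (x : R) : (forall i, is_derive x 1 (f i) (df i)) ->
  is_derive x 1 (fun y => \sum_(i <- s) f i y) (\sum_(i <- s) df i).
Proof.
move=> fdf; elim: s => [|i s IHs].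
  rewrite big_nil (_ : (fun _ => _) = cst 0); first exact: is_derive_cst.
  by apply/funext => y; rewrite big_nil.
rewrite big_cons (_ : (fun _ => _) = f i + fun y => \sum_(j <- s) f j y).
  exact: is_deriveD.
by apply/funext => y; rewrite big_cons.
Qed.

Lemma is_derive_within_continuous (R : realType) (f df : R -> R) (a b : R) :
  (forall x, x \in `[a, b] -> is_derive x 1 f (df x)) ->
  {within `[a, b]%classic, continuous f}.
Proof.
move=> dfx; apply: derivable_within_continuous => x xab.
by have [] := dfx x xab.
Qed.

(** Mean value theorem: [atan u] is [u / (1 + c ^+ 2)] with [c] between 0 and [u], and
    [1 - u ^+ 2 <= (1 + c ^+ 2)^-1 <= 1]. *)
Lemma atan_sub_cube (R : realType) (u : R) : 0 <= u ->
  u - u ^+ 3 <= atan u <= u.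
Proof.
move=> u0.
have d (x : R) : is_derive x 1 (atan : R -> R) (1 + x ^+ 2)^-1.
  exact: is_derive1_atan.
have [c cu] := MVT_segment u0 (fun x _ => d x)
  (is_derive_within_continuous (fun x _ => d x)).
rewrite atan0 !subr0 => ->; move: cu; rewrite in_itv /= => /andP[c0 cu].
have c2 : c ^+ 2 <= u ^+ 2 by rewrite lerXn2r.
have c20 : 0 <= c ^+ 2 by exact: sqr_ge0.
have p : 0 < 1 + c ^+ 2 by lra.
have -> : u - u ^+ 3 = (1 - u ^+ 2) * u by ring.
rewrite -{5}[u]mul1r !ler_wpM2r //.
  by rewrite invf_le1 //; lra.
rewrite -[leRHS]div1r ler_pdivlMr //; nra.
Qed.

(** Both bounds serve near 0: the cubic one where [atan] is multiplied by the large weight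
    [y^-1 ^+ 2], the crude one where the weight is [c ^+ 2]. *)
Lemma atan_cubic (R : realType) (v : R) :
  v - `|v| ^+ 3 <= atan v /\ - `|v| <= atan v.
Proof.
case: (ltP v 0) => v0.
  have u0 : 0 <= - v by lra.
  have := atan_sub_cube u0; rewrite atanN.
  have : 0 <= (- v) ^+ 3 by exact: exprn_ge0.
  rewrite ler0_norm ?(ltW v0) // opprK; lra.
have := atan_sub_cube v0; rewrite ger0_norm //.
have : 0 <= atan v by rewrite -(@atan0 R) le_atan.
lra.
Qed.

(** The angles [atan v] and [atan v^-1] are complementary, and [atan v^-1 <= v^-1]. *)
Lemma atan_ge_inv (R : realType) (v : R) : 0 < v -> pi / 2 - v^-1 <= atan v.
Proof.
move=> v0; have iv0 : 0 < v^-1 by rewrite invr_gt0.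
have w0 : 0 < atan v^-1 by rewrite -(@atan0 R) lt_atan.
have w1 := atan_ltpi2 v^-1.
have /andP[_ w2] := atan_sub_cube (ltW iv0).
suff -> : atan v = pi / 2 - atan v^-1 by lra.
rewrite -[RHS]tanK ?in_itv /=; last by apply/andP; split; lra.
congr atan; rewrite /tan sinB cosB sin_pihalf cos_pihalf !mul0r !mul1r.
by rewrite subr0 add0r -[LHS]invrK -{1}(atanK v^-1) /tan invfM invrK mulrC.
Qed.

(** The weight clears the denominator of the derivative of [atan (c * y)]; what remains is linear in
    [c] and cancels over a list of sum zero. *)
Lemma is_derive_sqrVD_atan (R : realType) (c x : R) : x != 0 ->
  is_derive x 1 (fun y => ((y^-1) ^+ 2 + c ^+ 2) * atan (c * y))
    (- 2 * x^-1 ^+ 3 * atan (c * x) + c * x^-1 ^+ 2).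
Proof.
move=> x0.
have dV : is_derive x 1 (fun y : R => y^-1) (- x^-1 ^+ 2).
  apply: DeriveDef; first exact: (@derivableV _ _ id).
  by rewrite (@deriveV _ _ id) // derive_id /GRing.scale /= mulr1 exprVn.
have d1 := is_deriveD (is_deriveX 2 dV) (is_derive_cst (c ^+ 2) x 1).
have d2 := is_deriveM d1 (is_derive_atanZ c x).
apply: is_derive_eq d2 _.
rewrite /GRing.scale /= addr0 !fctE /= expr1.
have p0 : 1 + (c * x) ^+ 2 != 0 by rewrite gt_eqF // ltr_pwDl // sqr_ge0.
by field; rewrite p0 x0.
Qed.

Lemma sum_mul_norm_ge0 (R : realType) (s : seq R) :
  \sum_(c <- s) c = 0 ->
  (forall y, 0 < y -> \sum_(c <- s) atan (c * y) <= 0) ->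
  0 <= \sum_(c <- s) c * `|c|.
Proof.
move=> s0 Theta.
pose K y : R := \sum_(c <- s) ((y^-1) ^+ 2 + c ^+ 2) * atan (c * y).
have mono a b : 0 < a -> a <= b -> K a <= K b.
  move=> a0 ab.
  have dK x : x \in `[a, b] -> is_derive x 1 K
      (\sum_(c <- s) (- 2 * x^-1 ^+ 3 * atan (c * x) + c * x^-1 ^+ 2)).
    rewrite in_itv /= => /andP[ax _].
    apply: is_derive_sum_seq => c; apply: is_derive_sqrVD_atan.
    by rewrite gt_eqF // (lt_le_trans a0).
  have dK' x : x \in `]a, b[ -> is_derive x 1 K
      (\sum_(c <- s) (- 2 * x^-1 ^+ 3 * atan (c * x) + c * x^-1 ^+ 2)).
    by move=> xab; apply: dK; exact: subset_itv_oo_cc.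
  have [c cab] := MVT_segment ab dK' (is_derive_within_continuous dK).
  move: cab; rewrite in_itv /= => /andP[ac _].
  rewrite big_split /= -mulr_suml s0 mul0r addr0 -mulr_sumr => E.
  have c0 : 0 < c by exact: lt_le_trans ac.
  rewrite -subr_ge0 E mulr_ge0 ?subr_ge0 // mulr_le0 ?Theta //.
  by rewrite mulNr oppr_le0 mulr_ge0 // exprn_ge0 // invr_ge0 ltW.
pose C3 : R := \sum_(c <- s) `|c| ^+ 3; pose C1 : R := \sum_(c <- s) `|c|.
have lower a : 0 < a -> - 2 * a * C3 <= K a.
  move=> a0.
  have -> : - 2 * a * C3 = \sum_(c <- s) (c * a^-1 - 2 * a * `|c| ^+ 3).
    by rewrite sumrB -mulr_suml s0 mul0r sub0r -mulr_sumr !mulNr.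
  apply: ler_sum => c _; rewrite [leRHS]mulrDl.
  have [A1 A2] := atan_cubic (c * a).
  move: A1 A2; rewrite normrM (gtr0_norm a0) => A1 A2.
  have -> : c / a - 2 * a * `|c| ^+ 3 =
    a^-1 ^+ 2 * (c * a - (`|c| * a) ^+ 3) + c ^+ 2 * - (`|c| * a).
    by rewrite -[c ^+ 2]real_normK ?num_real //; field; rewrite gt_eqF.
  by apply: lerD; apply: ler_wpM2l => //; exact: sqr_ge0.
(* The terms of weight [b^-1 ^+ 2] have a nonpositive sum by [Theta]; in the others, replacing
   [atan (c * b)] by its limit costs at most |c| / b. *)
have upper b : 0 < b -> K b <= pi / 2 * (\sum_(c <- s) c * `|c|) + C1 * b^-1.
  move=> b0; rewrite /K; under eq_bigr do rewrite mulrDl.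
  rewrite big_split /= -mulr_sumr -[leRHS]add0r.
  apply: lerD; first by rewrite mulr_ge0_le0 ?sqr_ge0 ?Theta.
  rewrite mulr_sumr mulr_suml -big_split /=; apply: ler_sum => c _.
  have ib0 : 0 < b^-1 by rewrite invr_gt0.
  case: (ltP c 0) => c0.
    have cb0 : 0 < - c * b by rewrite mulr_gt0 // oppr_gt0.
    have := atan_ge_inv cb0; rewrite ltr0_norm // mulNr atanN => h.
    have -> : pi / 2 * (c * - c) + - c / b =
       c ^+ 2 * - (pi / 2 - (- (c * b))^-1).
      have [bn cn] : b != 0 /\ c != 0 by rewrite (gt_eqF b0) (lt_eqF c0).
      by field; rewrite ?bn ?cn.
    by apply: ler_wpM2l; rewrite ?sqr_ge0 //; lra.
  rewrite ger0_norm // -[leLHS]addr0; apply: lerD; last by rewrite mulr_ge0 // ltW.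
  by rewrite -expr2 mulrC; apply: ler_wpM2r; rewrite ?sqr_ge0 // ltW // atan_ltpi2.
rewrite leNgt; apply/negP => S0.
set S := \sum_(c <- s) c * `|c| in upper S0.
have C10 : 0 <= C1 by apply: sumr_ge0.
have C30 : 0 <= C3 by apply: sumr_ge0 => c _; exact: exprn_ge0.
pose T := - (pi / 2 * S).
have T0 : 0 < T by rewrite /T oppr_gt0 pmulr_rlt0 // divr_gt0 ?pi_gt0.
(* Chaining [lower] at [b^-1] with [upper] at [b] and multiplying by [b] gives
   [b * T <= C1 + 2 * C3]; this [b] makes the left side larger by [T]. *)
pose b := 1 + (C1 + 2 * C3) / T.
have b1 : 1 <= b by rewrite lerDl divr_ge0 ?(ltW T0) // addr_ge0 // mulr_ge0.
have b0 : 0 < b by exact: lt_le_trans b1.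
have bT : b * T = T + C1 + 2 * C3 by rewrite /b; field; rewrite gt_eqF.
have ib0 : 0 < b^-1 by rewrite invr_gt0.
have ibb : b^-1 <= b by rewrite (le_trans _ b1) // invf_le1.
have := le_trans (lower _ ib0) (le_trans (mono _ _ ib0 ibb) (upper _ b0)).
rewrite -(ler_pM2r b0) mulrDl divfK ?gt_eqF //.
have -> : - 2 * b^-1 * C3 * b = - 2 * C3 by field; rewrite gt_eqF.
have -> : pi / 2 * S * b = - (b * T) by rewrite /T; ring.
rewrite bT; lra.
Qed.

(** Each factor has argument [atan u]. Adding these, rather than taking a principal argument of the
    product, gives an angle that depends continuously on the list. *)
Lemma prod_cos_sin (R : realType) (s : seq R) : exists2 r : R, 0 < r &
  \prod_(u <- s) (1 +i* u)%C =
    ((r * cos (\sum_(u <- s) atan u)) +i* (r * sin (\sum_(u <- s) atan u)))%C.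
Proof.
elim: s => [|u s [r r0 IHs]].
  by exists 1; rewrite ?ltr01 // !big_nil cos0 sin0 mulr1 mulr0.
have q0 : 0 < Num.sqrt (1 + u ^+ 2) by rewrite sqrtr_gt0 ltr_pwDl // sqr_ge0.
exists (Num.sqrt (1 + u ^+ 2) * r); first exact: mulr_gt0.
have cu := cos_atan u.
have su : sin (atan u) = u * cos (atan u).
  by rewrite -{2}(atanK u) /tan divfK // cu invr_eq0 gt_eqF.
rewrite !big_cons IHs cosD sinD su cu; apply/eqP.
by rewrite eq_complex /=; apply/andP; split; apply/eqP; field; rewrite gt_eqF.
Qed.

(** The total angle is continuous and is 0 at [y = 0]. A value strictly between 0 and [pi] has
    positive sine; a value of at least [pi] forces an earlier passage through [pi / 2], where the
    cosine vanishes. *)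
Lemma sum_atan_le0 (R : realType) (s : seq R) :
  (forall y, 0 < y ->
    0 < complex.Re (\prod_(c <- s) (1 +i* (c * y))%C) /\
    complex.Im (\prod_(c <- s) (1 +i* (c * y))%C) <= 0) ->
  forall y, 0 < y -> \sum_(c <- s) atan (c * y) <= 0.
Proof.
move=> reim.
pose Theta y : R := \sum_(c <- s) atan (c * y).
have cs y : 0 < y -> 0 < cos (Theta y) /\ sin (Theta y) <= 0.
  move=> /reim; have [r r0] := prod_cos_sin [seq c * y | c <- s].
  by rewrite !big_map => -> /=; rewrite pmulr_rgt0 // pmulr_rle0.
move=> y y0; rewrite -/(Theta y) leNgt; apply/negP => T0.
have [_ sT] := cs y y0.
case: (ltP (Theta y) pi) => Tpi.
  by have := sin_gt0_pi (x := Theta y); rewrite T0 Tpi => /(_ isT); lra.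
have Theta0 : Theta 0 = 0.
  by rewrite /Theta big1 // => c _; rewrite mulr0 atan0.
have pi0 := pi_gt0 R.
have cont : {within `[0, y]%classic, continuous Theta}.
  apply: (@is_derive_within_continuous _ _ _) => x _.
  by apply: is_derive_sum_seq => c; exact: is_derive_atanZ.
have [|c] := IVT (v := pi / 2) (ltW y0) cont.
  by rewrite Theta0 minEle maxEle (ltW T0); apply/andP; split; lra.
rewrite in_itv /= => /andP[c0 _] Tc.
have {}c0 : 0 < c.
  rewrite lt_neqAle c0 andbT; apply/eqP => c0'.
  by move: Tc; rewrite -c0' Theta0; lra.
by have [] := cs c c0; rewrite Tc cos_pihalf ltxx.
Qed.

(** * Determinants and characteristic polynomials *)

Lemma horner_char_poly (F : comNzRingType) n (A : 'M[F]_n) (x : F) :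
  (char_poly A).[x] = \det (x%:M - A).
Proof.
rewrite /char_poly -horner_evalE -det_map_mx; congr (\det _).
apply/matrixP => i j; rewrite !mxE /= rmorphB rmorphMn /= !horner_evalE.
by rewrite hornerX hornerC.
Qed.

Section CharPolyRoots.
Variables (n : nat).

Lemma size_char_poly_roots (F : idomainType) (A : 'M[F]_n) (s : seq F) :
  char_poly A = \prod_(c <- s) ('X - c%:P) -> size s = n.
Proof.
move=> As; have := size_char_poly A.
by rewrite As size_prod_XsubC => -[].
Qed.

(** Factoring out [- b] leaves the characteristic polynomial at [- (a / b)]; its [n] linear factors
    absorb the [n] copies of [- b]. *)
Lemma det_scalarD_scale (F : fieldType) (A : 'M[F]_n) (s : seq F) (a b : F) :
  char_poly A = \prod_(c <- s) ('X - c%:P) -> b != 0 ->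
  \det (a%:M + b *: A) = \prod_(c <- s) (a + b * c).
Proof.
move=> As b0.
have -> : a%:M + b *: A = (- b) *: ((- (a / b))%:M - A).
  apply/matrixP => i j; rewrite !mxE.
  by case: (i == j); rewrite ?mulr1n ?mulr0n; field.
rewrite detZ -horner_char_poly As -(size_char_poly_roots As) horner_prod.
have -> : (- b) ^+ size s = \prod_(c <- s) - b.
  by rewrite big_const_seq count_predT -Monoid.iteropE.
rewrite -big_split /=; apply: eq_bigr => c _.
by rewrite hornerXsubC; field.
Qed.

Lemma sum_char_poly_roots (F : idomainType) (A : 'M[F]_n) (s : seq F) :
  char_poly A = \prod_(c <- s) ('X - c%:P) -> \sum_(c <- s) c = \tr A.
Proof.
move=> As; have sn := size_char_poly_roots As.
have [n0|n0] := posnP n.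
  rewrite (size0nil (etrans sn n0)) big_nil /mxtrace big1 // => i.
  by have := leq_ltn_trans (leq0n i) (ltn_ord i); rewrite [in X in X -> _]n0.
have := coefPn_prod_XsubC (ps := s).
by rewrite sn -lt0n n0 -As char_poly_trace // => /(_ isT)/oppr_inj.
Qed.

(** The squares of the roots are the roots for [A *m A], to which the trace formula applies. *)
Lemma sum_sqr_char_poly_roots (F : numFieldType) (A : 'M[F]_n) (s : seq F) :
  char_poly A = \prod_(c <- s) ('X - c%:P) ->
  \sum_(c <- s) c ^+ 2 = \tr (A *m A).
Proof.
move=> As; rewrite -(big_map (fun c => c ^+ 2) xpredT id).
apply: sum_char_poly_roots; apply/eqP; rewrite -subr_eq0; apply/eqP.
set p := _ - _.
(* The two polynomials are compared at sufficiently many distinct squares, since there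
   [x ^+ 2 - A *m A] factors as (x - A)(x + A). *)
apply: (@roots_geq_poly_eq0 _ p [seq (i%:R : F) ^+ 2 | i <- iota 0 (size p)]).
- apply/allP => _ /mapP[i _ ->]; rewrite rootE !hornerE subr_eq0.
  rewrite horner_char_poly horner_prod big_map.
  set x : F := i%:R.
  have -> : (x ^+ 2)%:M - A *m A = (x%:M + (- 1) *: A) *m (x%:M + 1 *: A).
    rewrite scale1r scaleN1r mulmxDl !mulmxDr !mulNmx -scalar_mxM (scalar_mxC x A).
    by rewrite -expr2 addrA addrK.
  rewrite det_mulmx !(det_scalarD_scale _ As) ?oppr_eq0 ?oner_eq0 //.
  rewrite -big_split /=; apply/eqP; apply: eq_bigr => c _.
  by rewrite hornerXsubC; ring.
- rewrite map_inj_in_uniq ?iota_uniq // => a b _ _ /eqP.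
  by rewrite eqrXn2 ?ler0n // eqr_nat => /eqP.
- by rewrite size_map size_iota.
Qed.
End CharPolyRoots.

(* A permutation contributing to the Leibniz expansion moves no index to a
   lower height, and the total height is invariant, so it moves nothing. *)
Lemma det_unitriangular (F : comNzRingType) n (N : 'M[F]_n) (h : 'I_n -> nat) :
  (forall i, N i i = 1) ->
  (forall i j, i != j -> (h j <= h i)%N -> N i j = 0) -> \det N = 1.
Proof.
move=> N1 N0; rewrite /determinant (bigD1 (1%g : {perm 'I_n})) //= odd_perm1.
rewrite expr0 mul1r.
rewrite big1 ?big1 ?addr0 // => [s s1|i _]; last by rewrite perm1.
have [i si] : exists i, s i != i.
  apply/existsP; apply: contraNT s1 => /existsPn s1.
  by apply/eqP/permP => i; rewrite perm1; apply/eqP; have := s1 i; rewrite negbK.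
suff [k Nk] : exists k, N k (s k) = 0 by rewrite (bigD1 k) //= Nk mul0r mulr0.
have [/existsP[k /andP[sk hk]]|/existsPn H] :=
  boolP [exists k, (s k != k) && (h (s k) <= h k)%N].
  by exists k; apply: N0; rewrite // eq_sym.
have {}H k : (h k <= h (s k) ?= iff (s k == k))%N.
  have := H k; case: eqP => [->|_] /=; first by split; rewrite ?leqnn ?eqxx.
  by rewrite -ltnNge => hk; split; rewrite ?(ltnW hk) // ltn_eqF.
have [_] := leqif_sum (fun k (_ : true) => H k).
have -> : (\sum_k h (s k) = \sum_k h k)%N.
  by rewrite [RHS](reindex_inj (@perm_inj _ s)).
by rewrite eqxx => /esym/forall_inP/(_ i isT); rewrite (negPf si).
Qed.

(** * Elimination on a triangle with pendant paths *)

Section TrianglePathElimination.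
Variables j k l : nat.

Notation leg := (leg j k l).
Notation V := (Pvertex j k l).
Notation W := {i : 'I_3 & 'I_(leg i)}.

Definition below (v : V) : nat :=
  match v with
  | inl a => leg a
  | inr w => leg (tag w) - (tagged w).+1
  end.

(** Each path is rooted at its triangle vertex: the parent is the neighbour towards the triangle,
    and path edges correspond to path vertices. *)
Definition parent_of (w : W) (v : V) : bool :=
  match v with
  | inl a => (a == tag w) && (tagged w == 0 :> nat)%N
  | inr y => (tag y == tag w) && ((tagged y).+1 == tagged w :> nat)%N
  end.

Lemma parent_of_neq w : parent_of w (inr w) = false.
Proof. by rewrite /= eqxx gtn_eqF. Qed.

Lemma parent_of_unique w u v : parent_of w u -> parent_of w v -> u = v.
Proof.
case: u => [a|[a r]]; case: v => [b|[b s]] //=.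
- by move=> /andP[/eqP-> _] /andP[/eqP-> _].
- by move=> /andP[_ /eqP wE] /andP[_ /eqP]; rewrite wE.
- by move=> /andP[_ /eqP <-] /andP[_ /eqP].
case: w => c t /= /andP[/eqP ac /eqP rt] /andP[/eqP bc /eqP st].
subst a b; congr (inr (existT _ _ _)); apply: val_inj.
by apply: succn_inj; rewrite rt st.
Qed.

Lemma eq_parent_of (w1 w2 : W) v :
  parent_of w1 v -> parent_of w2 v -> w1 = w2.
Proof.
case: w1 w2 => [a r] [b s]; case: v => [c|[c t]] /=;
  move=> /andP[/eqP ca /eqP cr] /andP[/eqP cb /eqP cs];
  subst a b; congr existT; apply: val_inj => /=.
- by rewrite cr cs.
- by rewrite -cr -cs.
Qed.

Lemma below_gt0 v : (0 < below v)%N -> exists w, parent_of w v.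
Proof.
case: v => [a|[a r]] /= h.
  by exists (existT _ a (Ordinal h)); rewrite /= eqxx.
rewrite subn_gt0 in h.
by exists (existT _ a (Ordinal h)); rewrite /= !eqxx.
Qed.

Lemma below_parent w v : parent_of w v -> below v = (below (inr w)).+1.
Proof.
case: w => a r; case: v => [b|[b s]] /= /andP[/eqP ba /eqP rs]; subst b.
  by rewrite rs -subSn ?subSS ?subn0 // -rs.
by rewrite rs subnSK.
Qed.

Lemma sum_children (F : nmodType) (f : nat -> F) v :
  \sum_(w : W) (if parent_of w v then f (below (inr w)) else 0) =
    if below v is m.+1 then f m else 0.
Proof.
case E: (below v) => [|m].
  by rewrite big1 // => w _; case: ifP => // /below_parent; rewrite E.
have [|w0 w0v] := @below_gt0 v; first by rewrite E.
rewrite (bigD1 w0) //= w0v big1 ?addr0.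
  by congr f; have := below_parent w0v; rewrite E => -[].
move=> w ww0; case: ifP => // /eq_parent_of/(_ w0v) ww0'.
by rewrite ww0' eqxx in ww0.
Qed.

Definition triangle_edge (u v : V) : bool :=
  if (u, v) is (inl a, inl b) then a != b else false.

(** Charging each path edge to its endpoint farther from the triangle makes adjacency a sum over the
    eliminated path vertices. *)
Lemma Pedge_sum (F : pzSemiRingType) (u v : V) :
  (Pedge u v)%:R = (triangle_edge u v)%:R +
    \sum_(w : W) (((u == inr w) && parent_of w v)%:R +
                  ((v == inr w) && parent_of w u)%:R) :> F.
Proof.
have S (x y : V) : \sum_(w : W) ((x == inr w) && parent_of w y)%:R =
    (if x is inr z then parent_of z y else false)%:R :> F.
  case: x => [a|z]; first by rewrite big1.
  rewrite (bigD1 z) //= eqxx big1 ?addr0 // => w wz.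
  by case: eqP => // -[zw]; rewrite zw eqxx in wz.
rewrite big_split /= !S; case: u => [a|y]; case: v => [b|z] /=.
- by rewrite !addr0.
- by rewrite !add0r.
- by rewrite add0r addr0.
rewrite add0r -natrD; congr (_%:R).
rewrite (eq_sym (tag z)); case: (tag y == tag z) => //=.
move: (nat_of_ord (tagged y)) (nat_of_ord (tagged z)) => a b.
by case: (a.+1 =P b) => ?; case: (b.+1 =P a) => // ?; lia.
Qed.

Section Elimination.
Variables (F : fieldType) (x i : F).
Hypothesis sqri : i ^+ 2 = -1.

(* [pivot m] is the pivot of a vertex with [m] path vertices hanging below it,
   all of them already eliminated. *)
Fixpoint pivot (m : nat) : F := if m is p.+1 then x + (pivot p)^-1 else x.

Definition vertex_pivot (v : V) : F := pivot (below v).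

(** The diagonal entry left at triangle vertex [a] once its path is eliminated: one of p, q, r. *)
Definition corner (a : nat) : F := pivot (nth 0%N [:: j; k; l] a).

(* The triangle vertices are eliminated in the order 2, 1, 0. *)
Definition triangle_coef (a c : nat) : F :=
  match a, c with
  | 0%N, 1%N => (i + (corner 2)^-1) / (corner 1 + (corner 2)^-1)
  | 0%N, 2%N | 1%N, 2%N => i / corner 2
  | _, _ => (a == c)%:R
  end.

(** As [i ^+ 2 = -1], eliminating vertex 2 adds [(corner 2)^-1] to the two other diagonal entries
    and to the entry [i] between them. *)
Definition triangle_pivot (c : nat) : F :=
  match c with
  | 0%N => corner 0 + (corner 2)^-1
         - (i + (corner 2)^-1) ^+ 2 / (corner 1 + (corner 2)^-1)
  | 1%N => corner 1 + (corner 2)^-1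
  | _ => corner 2
  end.

(** When a path vertex is eliminated, its parent is its only remaining neighbour, hence one
    off-diagonal entry in its column. *)
Definition elim_coef (u w : V) : F :=
  match w with
  | inl c => if u is inl a then triangle_coef a c else 0
  | inr y => (u == w)%:R + (if parent_of y u then i / vertex_pivot w else 0)
  end.

Definition elim_pivot (w : V) : F :=
  if w is inl c then triangle_pivot c else vertex_pivot w.

Hypothesis pivot_neq0 : forall m, pivot m != 0.
Hypothesis corner12 : corner 1 * corner 2 + 1 != 0.

Lemma corner1D_neq0 : corner 1 + (corner 2)^-1 != 0.
Proof.
have c2 : corner 2 != 0 by exact: pivot_neq0.
rewrite (_ : _ + _ = (corner 1 * corner 2 + 1) / corner 2); last by field.
by rewrite mulf_neq0 // invr_neq0.
Qed.

Lemma triangle_elim (a b : 'I_3) :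
  \sum_(c < 3) triangle_coef a c * triangle_pivot c * triangle_coef b c =
    if a == b then corner a else i.
Proof.
have c2 : corner 2 != 0 by exact: pivot_neq0.
have c1 := corner1D_neq0.
rewrite !big_ord_recl big_ord0 addr0.
case: a => [[|[|[|a]]] ?] //; case: b => [[|[|[|b]]] ?] //=;
  rewrite /triangle_coef /triangle_pivot /= ?mulr1n ?mulr0n;
  by field : sqri; rewrite ?c1 ?c2 ?corner12.
Qed.

(** This is the 3 by 3 determinant pqr - i^2 (p + q + r) + 2 i^3. *)
Lemma prod_triangle_pivot : \prod_(c < 3) triangle_pivot c =
  corner 0 * corner 1 * corner 2 + corner 0 + corner 1 + corner 2 - 2 * i.
Proof.
have c2 : corner 2 != 0 by exact: pivot_neq0.
have c1 := corner1D_neq0.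
rewrite !big_ord_recl big_ord0 mulr1 /triangle_pivot /=.
by field : sqri; rewrite ?c1 ?c2 ?corner12.
Qed.

Lemma vertex_pivot_children u :
  \sum_(w : W) (if parent_of w u then (vertex_pivot (inr w))^-1 else 0) =
    vertex_pivot u - x.
Proof.
rewrite (sum_children (fun m => (pivot m)^-1)) /vertex_pivot.
by case: (below u) => [|m] /=; rewrite ?subrr // addrC addKr.
Qed.

(* Entrywise form of [xI + iA = L D L^T], with [L] = [elim_coef] unitriangular
   and [D] = [elim_pivot]. *)
Lemma elim_sum (u v : V) :
  \sum_w elim_coef u w * elim_pivot w * elim_coef v w =
    x * (u == v)%:R + i * (Pedge u v)%:R.
Proof.
rewrite big_sumType /=.
have Q0 w : vertex_pivot w != 0 by exact: pivot_neq0.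
pose same := if u is inl _ then 0 else vertex_pivot u * (u == v)%:R.
rewrite [X in _ + X](_ : _ = same
  + i * (\sum_(w : W) (((u == inr w) && parent_of w v)%:R +
                       ((v == inr w) && parent_of w u)%:R))
  - (vertex_pivot u - x) * (u == v)%:R); last first.
  (* With [q] the pivot of [w], column [w] contributes [q] on the diagonal at [w], [i] on the edge
     to the parent, and [i ^+ 2 / q = - q^-1] on the diagonal at the parent. *)
  transitivity (\sum_(w : W)
    ((vertex_pivot (inr w) * ((u == inr w) && (v == inr w))%:R
    + i * (((u == inr w) && parent_of w v)%:R + ((v == inr w) && parent_of w u)%:R))
    - (if parent_of w u then (vertex_pivot (inr w))^-1 else 0) * (u == v)%:R)).
    apply: eq_bigr => w _.
    move: (vertex_pivot (inr w)) (Q0 (inr w)) => q q0.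
    have [pu|pu] := boolP (parent_of w u); have [pv|pv] := boolP (parent_of w v).
    - have uv := parent_of_unique pu pv; subst v; rewrite eqxx.
      by case: (u == inr w) => /=; field : sqri; rewrite ?q0.
    - have -> : (u == v) = false by apply: contraNF pv => /eqP <-.
      case: (u == inr w); case: (v == inr w) => /=;
        by field : sqri; rewrite ?q0.
    - case: (u == inr w); case: (v == inr w) => /=;
        by field : sqri; rewrite ?q0.
    - case: (u == inr w); case: (v == inr w) => /=;
        by field : sqri; rewrite ?q0.
  rewrite sumrB big_split /= -mulr_sumr -mulr_suml vertex_pivot_children.
  congr (_ + _ - _); rewrite /same {same}.
  case: u => [a|y]; first by rewrite big1 // => w _; rewrite mulr0.
  rewrite (bigD1 y) //= eqxx big1 ?addr0 => [|w wy]; first by rewrite eq_sym.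
  by rewrite -[inr y == inr w]/(y == w) eq_sym (negPf wy) mulr0.
rewrite (Pedge_sum F u v) mulrDr /same {same}.
case: u => [a|y]; last first.
  rewrite -[triangle_edge _ _]/false mulr0 big1 => [|c _]; last by rewrite !mul0r.
  by ring.
case: v => [b|z]; last first.
  rewrite -[triangle_edge _ _]/false mulr0 big1 => [|c _]; last by rewrite mulr0.
  by have -> : (inl a == inr z :> V)%:R = 0 :> F by []; ring.
rewrite triangle_elim /= -[inl a == inl b]/(a == b).
have -> : vertex_pivot (inl a) = corner a by [].
by rewrite /triangle_edge; case: (a == b) => /=; ring.
Qed.

Lemma det_triangle_paths :
  \det (x%:M + i *: \matrix_(a, b < #|V|) (Pedge (enum_val a) (enum_val b))%:R) =
    (\prod_(w : W) vertex_pivot (inr w)) *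
    (corner 0 * corner 1 * corner 2 + corner 0 + corner 1 + corner 2 - 2 * i).
Proof.
pose L := \matrix_(a, b < #|V|) elim_coef (enum_val a) (enum_val b).
pose d := \row_(a < #|V|) elim_pivot (enum_val a).
have -> : x%:M + i *: \matrix_(a, b < #|V|) (Pedge (enum_val a) (enum_val b))%:R =
    L *m diag_mx d *m L^T.
  apply/matrixP => a b; rewrite mul_mx_diag !mxE.
  have := elim_sum (enum_val a) (enum_val b).
  rewrite (inj_eq enum_val_inj) mulr_natr => <-.
  rewrite (reindex _ (onW_bij _ (@enum_val_bij V))) /=.
  by apply: eq_bigr => c _; rewrite !mxE.
have L1 : \det L = 1.
  (* Every path vertex is higher than its parent, and the triangle vertices are lowest; off-diagonal
     entries of [L] sit only in columns higher than their row. *)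
  pose h (v : V) := match v with inl a => val a | inr w => (3 + tagged w)%N end.
  apply: (@det_unitriangular _ _ _ (h \o enum_val)) => [a|a b].
    rewrite mxE; case: (enum_val a) => [[[|[|[|?]]] ?]|w] //=.
    by rewrite eqxx ifF ?addr0 //; have := parent_of_neq w.
  rewrite mxE /= -(inj_eq enum_val_inj).
  case: (enum_val a) (enum_val b) => [s|y] [t|z] //=.
  - case: s t => [[|[|[|?]]] ?] [[|[|[|?]]] ?] //=.
  - move=> _ /leq_ltn_trans/(_ (ltn_ord s)).
    by rewrite -[X in (_ < X)%N]addn0 ltn_add2l.
  - move=> /negPf -> /=; rewrite leq_add2l leqNgt add0r.
    by case: ifP => // /andP[_ /eqP <-]; rewrite ltnSn.
rewrite !det_mulmx det_tr L1 mulr1 mul1r det_diag -prod_triangle_pivot.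
have -> : \prod_c d 0 c = \prod_w elim_pivot w.
  rewrite [RHS](reindex _ (onW_bij _ (@enum_val_bij V))) /=.
  by apply: eq_bigr => c _; rewrite mxE.
by rewrite big_sumType mulrC.
Qed.

End Elimination.

End TrianglePathElimination.

(** * Vertex and edge counts, and traces of the adjacency matrix *)

Lemma parent_exists (j k l : nat) (w : {i : 'I_3 & 'I_(leg j k l i)}) :
  exists v, parent_of w v.
Proof.
case: w => a [[|r] ra]; first by exists (inl a); rewrite /= eqxx.
by exists (inr (existT _ a (Ordinal (ltnW ra)))); rewrite /= !eqxx.
Qed.

Lemma card_path_vertices (j k l : nat) :
  #|{: {i : 'I_3 & 'I_(leg j k l i)}}| = (j + k + l)%N.
Proof.
rewrite card_tagged sumnE big_map big_enum /= !big_ord_recl big_ord0 !card_ord.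
by rewrite /leg /= addn0 addnA.
Qed.

Lemma card_triangle_paths (j k l : nat) : #|P j k l| = (j + k + l + 3)%N.
Proof. by rewrite card_sum card_path_vertices card_ord addnC. Qed.

(** There are as many edges as vertices: one per path vertex, to its parent, and three in the
    triangle; each is counted twice. *)
Lemma sum_Pedge (F : pzSemiRingType) (j k l : nat) :
  \sum_(u : P j k l) \sum_(v : P j k l) (Pedge u v)%:R =
    (2 * (j + k + l + 3))%:R :> F.
Proof.
have S (w : {i : 'I_3 & 'I_(leg j k l i)}) : \sum_(u : P j k l) \sum_(v : P j k l)
    ((u == inr w) && parent_of w v)%:R = 1 :> F.
  have [v0 wv0] := parent_exists w.
  rewrite (bigD1 (inr w)) //= eqxx (bigD1 v0) //= wv0 !big1 ?addr0 //.
  - by move=> u /negPf uw; rewrite big1 // => v _; rewrite uw.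
  - move=> v vv0; rewrite ?eqxx; case wv: (parent_of w v) => //.
    by rewrite (parent_of_unique wv wv0) eqxx in vv0.
under eq_bigr do (under eq_bigr do rewrite Pedge_sum; rewrite big_split /=).
rewrite big_split /=.
have -> : \sum_(u : P j k l) \sum_(v : P j k l) (triangle_edge u v)%:R = 6 :> F.
  rewrite big_sumType /= [X in _ + X]big1 ?addr0; last by move=> w _; rewrite big1.
  under eq_bigr do rewrite big_sumType /= [X in _ + X]big1 // addr0.
  by rewrite !big_ord_recl !big_ord0 /= ?addr0 ?add0r -!addrA.
have -> : \sum_(u : P j k l) \sum_(v : P j k l)
    \sum_(w : {i : 'I_3 & 'I_(leg j k l i)})
    (((u == inr w) && parent_of w v)%:R + ((v == inr w) && parent_of w u)%:R) =
    \sum_(w : {i : 'I_3 & 'I_(leg j k l i)}) 2 :> F.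
  under eq_bigr do rewrite exchange_big /=.
  rewrite exchange_big /=; apply: eq_bigr => w _.
  under eq_bigr do rewrite big_split /=.
  by rewrite big_split /= S exchange_big /= S.
rewrite sumr_const -mulrnA -natrD card_path_vertices.
by congr (_%:R); lia.
Qed.

Lemma tr_adjacency (R : realType) (G : sgraph) : \tr (adjacency R G) = 0.
Proof. by rewrite /mxtrace big1 // => a _; rewrite mxE edge_irrefl. Qed.

Lemma tr_sqr_adjacency (R : realType) (G : sgraph) :
  \tr (adjacency R G *m adjacency R G) = \sum_(u : G) \sum_(v : G) (edge u v)%:R.
Proof.
rewrite [RHS](reindex _ (onW_bij _ (@enum_val_bij G))) /=; apply: eq_bigr => a _.
rewrite mxE [RHS](reindex _ (onW_bij _ (@enum_val_bij G))) /=.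
apply: eq_bigr => b _; rewrite !mxE (edge_sym (enum_val b)).
by case: (edge _ _); rewrite ?mulr0 ?mulr1.
Qed.

(** * The product over the spectrum, and the bound on the positive square energy *)

Lemma pivot_gt0 (R : realFieldType) (x : R) m : 0 < x -> 0 < pivot x m.
Proof. by move=> x0; elim: m => [|m IHm] //=; rewrite addr_gt0 ?invr_gt0. Qed.

Lemma rmorph_pivot (F K : fieldType) (f : {rmorphism F -> K}) (x : F) m :
  pivot (f x) m = f (pivot x m).
Proof. by elim: m => [|m IHm] //=; rewrite IHm rmorphD fmorphV. Qed.

(** The determinant of x + iA is computed by eigenvalues and by elimination. The pivots come from
    positive reals, so only the term [- 2 * i] of the triangle factor is not real. *)
Lemma prod_eigenvalues_triangle_paths (R : realType) (j k l : nat) (x : R) :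
  0 < x -> exists r p : R, [/\ 0 < r, 0 < p &
    \prod_(c <- eigenvalues (adjacency R (P j k l))) (x +i* c)%C =
      ((r * p) -i* (2 * r))%C].
Proof.
move=> x0; set A := adjacency R (P j k l).
have sqri : ('i%C : R[i]) ^+ 2 = -1 by exact: complex.sqr_i.
have A_split : char_poly (map_mx (real_complex R) A) =
    \prod_(c <- map (real_complex R) (eigenvalues A)) ('X - c%:P).
  rewrite -map_char_poly (prod_eigenvalues (adjacency_sym R (P j k l))).
  rewrite rmorph_prod big_map; apply: eq_bigr => c _.
  by rewrite rmorphB /= map_polyX map_polyC.
have i0 : ('i%C : R[i]) != 0 by rewrite -sqrf_eq0 sqri oppr_eq0 oner_eq0.
have piv m := pivot_gt0 m x0.
have piv0 m : pivot (real_complex R x) m != 0.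
  by rewrite rmorph_pivot fmorph_eq0 gt_eqF.
have c12 : corner j k l (real_complex R x) 1 *
    corner j k l (real_complex R x) 2 + 1 != 0.
  rewrite /corner !rmorph_pivot -rmorphM -(rmorph1 (real_complex R)).
  rewrite -rmorphD fmorph_eq0.
  by rewrite gt_eqF // addr_gt0 // mulr_gt0.
have adjE : \matrix_(a, b < #|Pvertex j k l|) (Pedge (enum_val a) (enum_val b))%:R =
    map_mx (real_complex R) A.
  apply/matrixP => a b; rewrite /A !mxE.
  by rewrite /=; case: (Pedge _ _); rewrite ?rmorph1 ?rmorph0.
have detE := det_triangle_paths sqri piv0 c12.
rewrite adjE in detE.
have := etrans (esym (det_scalarD_scale (real_complex R x) A_split i0)) detE.
rewrite big_map => {}detE.
exists (\prod_(w : {i : 'I_3 & 'I_(leg j k l i)}) vertex_pivot x (inr w)).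
exists (corner j k l x 0 * corner j k l x 1 * corner j k l x 2
  + corner j k l x 0 + corner j k l x 1 + corner j k l x 2).
split; first by apply: prodr_gt0 => w _; exact: piv.
  by rewrite !addr_gt0 ?mulr_gt0 //; exact: piv.
transitivity (\prod_(c <- eigenvalues A)
    (real_complex R x + 'i%C * real_complex R c)).
  apply: eq_bigr => c _; apply/eqP; rewrite eq_complex /=.
  by apply/andP; split; apply/eqP; ring.
rewrite detE.
under eq_bigr do rewrite /vertex_pivot rmorph_pivot.
rewrite -rmorph_prod /corner !rmorph_pivot -!rmorphM -!rmorphD /=.
by apply/eqP; rewrite eq_complex /=; apply/andP; split; apply/eqP; ring.
Qed.

Theorem theorem4p1 (R : realType) (j k l : nat) :
  #|P j k l| = (j + k + l + 3)%N /\
  s_plus R (P j k l) >= (j + k + l + 3)%:R.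
Proof.
split; first exact: card_triangle_paths.
have A_split := prod_eigenvalues (adjacency_sym R (P j k l)).
have sum0 := sum_char_poly_roots A_split; rewrite tr_adjacency in sum0.
have sum2 := sum_sqr_char_poly_roots A_split.
rewrite tr_sqr_adjacency sum_Pedge in sum2.
have : 0 <= \sum_(c <- eigenvalues (adjacency R (P j k l))) c * `|c|.
  apply: sum_mul_norm_ge0 sum0 _; apply: sum_atan_le0 => y y0.
  have iy0 : 0 < y^-1 by rewrite invr_gt0.
  have [r [p [r0 p0 E]]] := prod_eigenvalues_triangle_paths j k l iy0.
  set s := eigenvalues _ in E *.
  (* Pulling [y] out of each factor reduces to the determinant at [x = y^-1]. *)
  have -> : \prod_(c <- s) (1 +i* (c * y))%C =
      real_complex R (y ^+ size s) * \prod_(c <- s) (y^-1 +i* c)%C.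
    rewrite rmorphXn /= -iter_mulr_1 -(count_predT s) -big_const_seq -big_split.
    apply: eq_bigr => c _; apply/eqP; rewrite eq_complex /=.
    by apply/andP; split; apply/eqP; field; rewrite gt_eqF.
  have ys : 0 < y ^+ size s by exact: exprn_gt0.
  rewrite E /= !mul0r subr0 addr0 mulrN oppr_le0.
  by split; rewrite ?mulr_gt0 // ltW ?mulr_gt0.
rewrite /s_plus; set s := eigenvalues _ in sum2 *.
(* Nonnegativity of this sum thus says that twice [s_plus] is at least the trace of the squared
   adjacency matrix, which is 2n. *)
have -> : \sum_(c <- s) c * `|c| =
    2 * \sum_(c <- s | 0 < c) c ^+ 2 - \sum_(c <- s) c ^+ 2.
  rewrite [X in 2 * X - _]big_mkcond /= mulr_sumr -sumrB; apply: eq_bigr => c _.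
  by case: ltP => c0; rewrite ?(gtr0_norm c0) ?(ler0_norm c0); ring.
by rewrite sum2 natrM; lra.
Qed.
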